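(* Let $k$ be any field, $r\ge 1$ an integer, and $\mathbf d=(d_1,d_2)\in\mathbb Z^2$. Then $$b^0\bigl(\mathcal M_{k,r,\mathbf d}\bigr)=\mathrm{GRRR}_r(d_1,d_2)+1 .$$
   Context: **Category and sheaves.** Let $\mathcal C_{2V}$ be the category with objects $A_1,A_2,B_1,B_2,B_3$ whose non-identity morphisms are exactly one morphism for each of $A_1\to B_1$, $A_2\to B_2$, $A_1\to B_3$, $A_2\to B_3$. A sheaf of $k$-vector spaces $\mathcal F$ on $\mathcal C_{2V}$ is a contravariant functor to $k$-vector spaces: vector spaces $\mathcal F(P)$ for each object $P$ and a linear restriction map $\mathcal F(A_i,B_j):\mathcal F(B_j)\to\mathcal F(A_i)$ for each non-identity morphism $A_i\to B_j$. A global section is a family $f_P\in\mathcal F(P)$ over all objects $P$ with $\mathcal F(A_i,B_j)f_{B_j}=f_{A_i}$ for each morphism $A_i\to B_j$; these form the $k$-vector space $\Gamma(\mathcal F)$, and $b^0(\mathcal F)=\dim_k\Gamma(\mathcal F)$. **The sheaf $\mathcal M=\mathcal M_{k,r,\mathbf d}$.** Its values are $\mathcal M(B_1)=k[y_1]$, $\mathcal M(B_2)=k[y_2]$, $\mathcal M(B_3)=k[v,1/v]^{\oplus r}$, $\mathcal M(A_1)=k[x_1,1/x_1]$, $\mathcal M(A_2)=k[x_2,1/x_2]$ with $x_1,x_2,y_1,y_2,v$ indeterminates. Its restriction maps are: for $i=1,2$, $\mathcal M(A_i,B_i)(p(y_i))=x_i^{d_i}p(1/x_i)$; $\mathcal M(A_1,B_3)(q_1(v),\dots,q_r(v))=\sum_{j=1}^r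 x_1^{j-1}q_j(x_1^{r})$; $\mathcal M(A_2,B_3)(q_1(v),\dots,q_r(v))=\sum_{j=1}^r x_2^{j-1}q_j(x_2^{-r})$. **Graph Riemann-Roch rank** (of the divisor $\mathbf d$ on the graph with two vertices joined by $r$ edges). Two elements (divisors) of $\mathbb Z^2$ are equivalent if their difference lies in $\mathbb Z(r,-r)$ (the image of the graph Laplacian). A divisor is effective if both components are non-negative. $\mathrm{GRRR}_r(\mathbf d)=-1$ if $\mathbf d$ is not equivalent to an effective divisor; otherwise it is the largest integer $m\ge 0$ such that for every $\mathbf m\in\mathbb Z^2$ with non-negative components and component sum $m$, $\mathbf d-\mathbf m$ is equivalent to an effective divisor. *)

(* Defs.v *)
From HB Require Import structures.
From mathcomp Require Import all_boot all_order all_algebra.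
From mathcomp Require Import finmap monalg.
From mathcomp Require Import boolp classical_sets constructive_ereal.

Set Implicit Arguments.
Unset Strict Implicit.
Unset Printing Implicit Defensive.

Import Order.TTheory GRing.Theory Num.Theory.
Local Open Scope ring_scope.

(* [monalg] only puts a ring structure on [{malg R[M]}] for monoids [M] whose
   only unit is 1, which excludes the exponents [int]; only the module structure
   is reused, and the convolution product is supplied here. *)
Definition laurent (k : fieldType) : Type := {malg k[int]}.

HB.instance Definition _ (k : fieldType) := Choice.on (laurent k).
HB.instance Definition _ (k : fieldType) := GRing.Lmodule.on (laurent k).

Section LaurentRing.
Variable k : fieldType.
Implicit Types (f g h : laurent k) (n : int) (c : k).

(* The monomial x^n, for n of either sign. *)
Definition lmon n : laurent k := << n >>.

Definition lmul f g : laurent k :=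
  \sum_(i <- msupp f) \sum_(j <- msupp g) << f@_i * g@_j *g i + j >>.

Lemma lmulE (d1 d2 : {fset int}) f g :
  (msupp f `<=` d1)%fset -> (msupp g `<=` d2)%fset ->
  lmul f g = \sum_(i <- d1) \sum_(j <- d2) << f@_i * g@_j *g i + j >>.
Proof.
move=> le1 le2; rewrite /lmul (big_fset_incl _ le1) /=.
  apply/eq_bigr=> i _; apply/big_fset_incl => // j _ /mcoeff_outdom ->.
  by rewrite mulr0 monalgU0.
move=> i _ /mcoeff_outdom fi.
by rewrite big1 => // j _; rewrite fi mul0r monalgU0.
Qed.

Lemma lmulC : commutative lmul.
Proof.
move=> f g; rewrite /lmul exchange_big; apply: eq_bigr => i _.
by apply: eq_bigr => j _; rewrite mulrC addrC.
Qed.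

Lemma lmulDl : left_distributive lmul +%R.
Proof.
move=> f g h.
have lef := fsubsetUl (msupp f) (msupp g).
have leg := fsubsetUr (msupp f) (msupp g).
have leh := fsubset_refl (msupp h).
rewrite (lmulE (msuppD_le f g) leh) (lmulE lef leh) (lmulE leg leh).
rewrite -big_split /=; apply/eq_bigr=> i _.
rewrite -big_split /=; apply/eq_bigr=> j _.
by rewrite mcoeffD mulrDl monalgUD.
Qed.

Lemma lmulDr : right_distributive lmul +%R.
Proof. by move=> f g h; rewrite lmulC lmulDl !(lmulC f). Qed.

Lemma lmul0g : left_zero 0 lmul.
Proof. by move=> f; rewrite /lmul msupp0 big_seq_fset0. Qed.

Lemma lmulg0 : right_zero 0 lmul.
Proof. by move=> f; rewrite lmulC lmul0g. Qed.

Lemma lmulUU c1 c2 (i j : int) :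
  lmul << c1 *g i >> << c2 *g j >> = << c1 * c2 *g i + j >>.
Proof. by rewrite (lmulE msuppU_le msuppU_le) !big_seq_fset1 !mcoeffUU. Qed.

Lemma laurent_ind (P : laurent k -> Prop) :
  P 0 -> (forall f g, P f -> P g -> P (f + g)) ->
  (forall c n, P << c *g n >>) -> forall f, P f.
Proof. by move=> P0 PD PU f; rewrite [f]monalgE; apply: big_ind. Qed.

Lemma lmulA : associative lmul.
Proof.
move=> f g h; elim/laurent_ind: f => [|f1 f2 IH1 IH2|c1 i].
- by rewrite !lmul0g.
- by rewrite !lmulDl IH1 IH2.
elim/laurent_ind: g => [|g1 g2 IH1 IH2|c2 j].
- by rewrite lmul0g !lmulg0 lmul0g.
- by rewrite !(lmulDl, lmulDr) IH1 IH2.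
elim/laurent_ind: h => [|h1 h2 IH1 IH2|c3 l].
- by rewrite !lmulg0.
- by rewrite !lmulDr IH1 IH2.
by rewrite !lmulUU mulrA addrA.
Qed.

Lemma lmul1g : left_id (lmon 0) lmul.
Proof.
elim/laurent_ind => [|f g IHf IHg|c n]; first exact: lmulg0.
  by rewrite lmulDr IHf IHg.
by rewrite lmulUU mul1r add0r.
Qed.

Lemma lmon0_neq0 : lmon 0 != 0.
Proof. by rewrite monalgU_eq0 oner_eq0. Qed.

HB.instance Definition _ := GRing.Zmodule_isComNzRing.Build (laurent k)
  lmulA lmulC lmul1g lmulDl lmon0_neq0.

Lemma lscaleAl c f g : c *: (f * g) = (c *: f) * g.
Proof.
have sE h : c *: h = (<< c *g 0 >> : laurent k) * h.
  elim/laurent_ind: h => [|h1 h2 IH1 IH2|b n]; first by rewrite scaler0 mulr0.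
    by rewrite scalerDr mulrDr IH1 IH2.
  rewrite [RHS]lmulUU add0r; apply/malgP => j.
  by rewrite mcoeffZ !mcoeffU mulrnAr.
by rewrite !sE mulrA.
Qed.

HB.instance Definition _ :=
  GRing.Lmodule_isLalgebra.Build k (laurent k) lscaleAl.
HB.instance Definition _ :=
  GRing.Lalgebra_isComAlgebra.Build k (laurent k).

Lemma lmonD m n : lmon (m + n) = lmon m * lmon n.
Proof. by rewrite [RHS]lmulUU mulr1. Qed.

Lemma lmon0 : lmon 0 = 1. Proof. by []. Qed.

Lemma laurentE f : f = \sum_(i <- msupp f) f@_i *: lmon i.
Proof.
rewrite {1}[f]monalgE; apply: eq_bigr => i _; apply/malgP => j.
by rewrite mcoeffZ !mcoeffU mulrnAr mulr1.
Qed.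

(* [lsubst e q] is q(x^e), for e of either sign. *)
Definition lsubst (e : int) f : laurent k :=
  \sum_(i <- msupp f) f@_i *: lmon (e * i).

Lemma lsubstE e (D : {fset int}) f : (msupp f `<=` D)%fset ->
  lsubst e f = \sum_(i <- D) f@_i *: lmon (e * i).
Proof.
move=> le; rewrite /lsubst; apply: big_fset_incl => // j _ /mcoeff_outdom ->.
by rewrite scale0r.
Qed.

Lemma lsubst_is_linear e : linear (lsubst e).
Proof.
move=> c f g; set D := (msupp f `|` msupp g)%fset.
have leD : (msupp (c *: f + g) `<=` D)%fset.
  by apply: fsubset_trans (msuppD_le _ _) _; apply: fsetSU; apply: msuppZ_le.
rewrite (lsubstE e leD) (lsubstE e (fsubsetUl (msupp f) (msupp g))).
rewrite (lsubstE e (fsubsetUr (msupp f) (msupp g))) scaler_sumr -big_split /=.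
by apply: eq_bigr => i _; rewrite mcoeffD mcoeffZ scalerDl scalerA.
Qed.

HB.instance Definition _ e :=
  GRing.isLinear.Build k (laurent k) (laurent k) *:%R (lsubst e)
    (lsubst_is_linear e).

Lemma lsubstU e c n : lsubst e << c *g n >> = << c *g e * n >>.
Proof.
rewrite (lsubstE e msuppU_le) big_seq_fset1 mcoeffUU; apply/malgP => j.
by rewrite mcoeffZ !mcoeffU mulrnAr mulr1.
Qed.

Lemma lsubst_lmon e n : lsubst e (lmon n) = lmon (e * n).
Proof. exact: lsubstU. Qed.

Lemma lsubstM e f g : lsubst e (f * g) = lsubst e f * lsubst e g.
Proof.
elim/laurent_ind: f => [|f1 f2 IH1 IH2|a i]; first by rewrite mul0r !linear0 mul0r.
  by rewrite mulrDl !(raddfD (lsubst e)) /= mulrDl IH1 IH2.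
elim/laurent_ind: g => [|g1 g2 IH1 IH2|b j]; first by rewrite mulr0 !linear0 mulr0.
  by rewrite mulrDr !(raddfD (lsubst e)) /= mulrDr IH1 IH2.
by rewrite [X in lsubst e X]lmulUU !lsubstU [RHS]lmulUU mulrDr.
Qed.

End LaurentRing.

Section Dimension.
Variables (k : fieldType) (V : lmodType k).

Definition is_basis (n : nat) (b : 'I_n -> V) : Prop :=
  (forall c : 'I_n -> k, \sum_i c i *: b i = 0 -> forall i, c i = 0) /\
  (forall v, exists c : 'I_n -> k, v = \sum_i c i *: b i).

(* +oo when [V] has no finite basis; [dimE] shows independence of the basis. *)
Definition dim : \bar int :=
  xget +oo%E [set x | exists (n : nat) (b : 'I_n -> V),
                        is_basis b /\ x = (n%:Z)%:E].

Lemma is_basis_leq m n (a : 'I_m -> V) (b : 'I_n -> V) :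
  is_basis a -> is_basis b -> (m <= n)%N.
Proof.
move=> [freea _] [_ spanb].
have [C aE] := choice (fun i => spanb (a i)).
pose M := \matrix_(i < m, j < n) C i j.
suff /eqP <- : row_free M by apply: rank_leq_col.
apply/row_freeP/row_freeP; rewrite -kermx_eq0; apply/eqP/row_matrixP => i.
set u := row i _; have uM : u *m M = 0 by rewrite -row_mul mulmx_ker row0.
rewrite row0; apply/rowP => j; rewrite [RHS]mxE.
move: j; apply: freea.
under eq_bigr do rewrite aE scaler_sumr.
rewrite exchange_big big1 //= => l _.
under eq_bigr do rewrite scalerA.
rewrite -scaler_suml; have /rowP/(_ l) := uM; rewrite !mxE => uMl.
rewrite [X in X *: _](_ : _ = 0) ?scale0r // -[RHS]uMl.
by apply: eq_bigr => h _; rewrite !mxE.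
Qed.

Lemma dimE n (b : 'I_n -> V) : is_basis b -> dim = (n%:Z)%:E.
Proof.
move=> bB; apply: xget_unique; first by exists n, b.
move=> _ [m [a [aB ->]]]; congr (_%:Z%:E); apply/eqP.
by rewrite eqn_leq (is_basis_leq aB bB) (is_basis_leq bB aB).
Qed.

End Dimension.

Inductive obj := A1 | A2 | B1 | B2 | B3.

Inductive arrow : obj -> obj -> Type :=
| A1B1 : arrow A1 B1
| A2B2 : arrow A2 B2
| A1B3 : arrow A1 B3
| A2B3 : arrow A2 B3.

(* No two non-identity morphisms are composable, so functoriality imposes no
   condition on the restriction maps. *)
Record sheaf (k : fieldType) := Sheaf {
  shval :> obj -> lmodType k;
  shres : forall P Q : obj, arrow P Q -> {linear shval Q -> shval P}
}.
Arguments shres {k} s {P Q} _.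

Record sections (k : fieldType) (F : sheaf k) := Sections {
  sfam :> forall P, F P;
  sfamP : forall P Q (a : arrow P Q), shres F a (sfam Q) = sfam P
}.

HB.instance Definition _ k F := gen_eqMixin (@sections k F).
HB.instance Definition _ k F := gen_choiceMixin (@sections k F).

Section GlobalSections.
Variables (k : fieldType) (F : sheaf k).
Implicit Types f g h : sections F.

Lemma sections_eq f g : (forall P, f P = g P) -> f = g.
Proof.
case: f g => [f fP] [g gP] /= fg.
have {}fg : f = g by apply: functional_extensionality_dep.
by subst g; congr Sections; apply: Prop_irrelevance.
Qed.

Definition sec0 : sections F :=
  @Sections k F (fun P => 0) (fun P Q a => raddf0 (shres F a)).

Fact secN_subproof f P Q (a : arrow P Q) : shres F a (- f Q) = - f P.
Proof. by rewrite raddfN /= sfamP. Qed.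
Definition secN f := @Sections k F (fun P => - f P) (secN_subproof f).

Fact secD_subproof f g P Q (a : arrow P Q) :
  shres F a (f Q + g Q) = f P + g P.
Proof. by rewrite raddfD /= !sfamP. Qed.
Definition secD f g := @Sections k F (fun P => f P + g P) (secD_subproof f g).

Fact secZ_subproof (c : k) f P Q (a : arrow P Q) :
  shres F a (c *: f Q) = c *: f P.
Proof. by rewrite linearZ /= sfamP. Qed.
Definition secZ c f := @Sections k F (fun P => c *: f P) (secZ_subproof c f).

Fact secDA : associative secD.
Proof. by move=> f g h; apply: sections_eq => P /=; rewrite addrA. Qed.
Fact secDC : commutative secD.
Proof. by move=> f g; apply: sections_eq => P /=; rewrite addrC. Qed.
Fact secD0 : left_id sec0 secD.
Proof. by move=> f; apply: sections_eq => P /=; rewrite add0r. Qed.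
Fact secDN : left_inverse sec0 secN secD.
Proof. by move=> f; apply: sections_eq => P /=; rewrite addNr. Qed.

HB.instance Definition _ :=
  GRing.isZmodule.Build (sections F) secDA secDC secD0 secDN.

Fact secZA (b c : k) f : secZ b (secZ c f) = secZ (b * c) f.
Proof. by apply: sections_eq => P /=; rewrite scalerA. Qed.
Fact secZ1 : left_id 1 secZ.
Proof. by move=> f; apply: sections_eq => P /=; rewrite scale1r. Qed.
Fact secZDr : right_distributive secZ +%R.
Proof. by move=> c f g; apply: sections_eq => P /=; rewrite scalerDr. Qed.
Fact secZDl f : {morph secZ^~ f : b c / b + c}.
Proof. by move=> b c; apply: sections_eq => P /=; rewrite scalerDl. Qed.

HB.instance Definition _ :=
  GRing.Zmodule_isLmodule.Build k (sections F) secZA secZ1 secZDr secZDl.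

Definition b0 : \bar int := dim (sections F).

End GlobalSections.

Section SheafM.
Variables (k : fieldType) (r : nat) (d : int * int).

Definition Mval (P : obj) : lmodType k :=
  match P with
  | A1 | A2 => laurent k
  | B1 | B2 => {poly k}
  | B3 => {ffun 'I_r -> laurent k}
  end.

Definition resB (n : int) (p : {poly k}) : laurent k :=
  lmon k n * horner_alg (lmon k (-1)) p.

(* Indices start at 0, so the exponent j-1 of the usual convention is j here. *)
Definition resB3 (e : int) (q : {ffun 'I_r -> laurent k}) : laurent k :=
  \sum_(j < r) lmon k j * lsubst e (q j).

Lemma resB_is_linear n : linear (resB n).
Proof.
by move=> c p q; rewrite /resB linearP /= mulrDr mulr_algl scalerAr.
Qed.

HB.instance Definition _ n :=
  GRing.isLinear.Build k {poly k} (laurent k) *:%R (resB n) (resB_is_linear n).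

Lemma resB3_is_linear e : linear (resB3 e).
Proof.
move=> c p q; rewrite /resB3 scaler_sumr -big_split /=.
by apply: eq_bigr => j _; rewrite !ffunE linearP /= mulrDr -scalerAr.
Qed.

HB.instance Definition _ e :=
  GRing.isLinear.Build k {ffun 'I_r -> laurent k} (laurent k) *:%R (resB3 e)
    (resB3_is_linear e).

Definition Mres (P Q : obj) (a : arrow P Q) : {linear Mval Q -> Mval P} :=
  match a in arrow P Q return {linear Mval Q -> Mval P} with
  | A1B1 => resB d.1
  | A2B2 => resB d.2
  | A1B3 => resB3 r%:Z
  | A2B3 => resB3 (- r%:Z)
  end.

Definition sheafM : sheaf k := Sheaf Mres.

End SheafM.

Section GraphRank.
Variable r : nat.
Implicit Types d e : int * int.

Definition div_equiv d e : Prop :=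
  exists z : int, d - e = (r%:Z, - r%:Z) *~ z.

Definition effective d : Prop := 0 <= d.1 /\ 0 <= d.2.

Definition equiv_effective d : Prop := exists e, div_equiv d e /\ effective e.

Definition rank_ge d (m : nat) : Prop :=
  forall e, effective e -> e.1 + e.2 = m%:Z -> equiv_effective (d - e).

Definition is_max_rank d (m : nat) : Prop :=
  rank_ge d m /\ forall n, rank_ge d n -> (n <= m)%N.

(* [GRRR_max] below shows that the default value of [xget] is never used. *)
Definition GRRR d : int :=
  if `[< equiv_effective d >]
  then xget (-1) [set z | exists m : nat, is_max_rank d m /\ z = m%:Z]
  else -1.

Lemma equiv_effective_deg d : equiv_effective d -> 0 <= d.1 + d.2.
Proof.
case=> e [[z dez] [e1 e2]]; have -> : d.1 + d.2 = e.1 + e.2; last exact: addr_ge0.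
have /(congr1 fst) := dez; have /(congr1 snd) := dez.
rewrite !raddfMz /= => /eqP; rewrite subr_eq => /eqP -> /eqP.
rewrite subr_eq => /eqP ->; rewrite mulNrz addrACA subrr add0r //.
Qed.

Lemma GRRR_max d : equiv_effective d ->
  exists m : nat, is_max_rank d m /\ GRRR d = m%:Z.
Proof.
move=> dE.
have rk0 : exists n, `[< rank_ge d n >].
  exists 0%N; apply/asboolP => e [e1 e2] e0; suff -> : e = 0 by rewrite subr0.
  case: e e1 e2 e0 => [x y] /= x0 y0 /eqP.
  by rewrite paddr_eq0 // => /andP[/eqP -> /eqP ->].
have rk_le n : `[< rank_ge d n >] -> (n <= absz (d.1 + d.2)%R)%N.
  move=> /asboolP /(_ (n%:Z, 0)) /(_ (conj (le0z_nat n) (lexx _))) /=.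
  rewrite addr0 => /(_ erefl) /equiv_effective_deg /=.
  rewrite subr0 addrAC subr_ge0 => le.
  by rewrite -lez_nat gez0_abs //; apply: le_trans le.
case: (ex_maxnP rk0 rk_le) => m /asboolP mP mM.
have mmax : is_max_rank d m by split=> // n nP; apply: mM; apply/asboolP.
exists m; split=> //; rewrite /GRRR asboolT //; apply: xget_unique.
  by exists m.
move=> _ [n [[nP nM] ->]]; congr Posz; apply/eqP; rewrite eqn_leq.
by rewrite nM // mmax.2.
Qed.

End GraphRank.

(* Main.v *)
Require Import Defs.
From mathcomp Require Import all_boot all_order all_algebra.
From mathcomp Require Import finmap monalg zify.
From mathcomp Require Import boolp constructive_ereal.
From HB Require Import structures.

(* A section is determined by its value at B3.  The monomial v^n in slot j
   (0 <= j < r) restricts to x_1^(j + r n) and x_2^(j - r n), distinct (j, n)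
   giving distinct exponents, so the sections have a basis indexed by the pairs
   with j + r n <= d_1 and j - r n <= d_2.  Slot j contributes
   max (0, floor ((d_1 - j) / r) + floor ((d_2 - j) / r) + 1) of them.
   On the graph side, a divisor e is equivalent to an effective one iff
   0 <= floor (e_1 / r) + floor (e_2 / r).  Writing d_i = q_i r + s_i with
   0 <= s_i < r and D = q_1 + q_2, the sum over j and the rank plus one are both
   0 if D < 0, min (s_1, s_2) + 1 if D = 0, and (D - 1) r + s_1 + s_2 + 2 if
   D > 0. *)

Set Implicit Arguments.
Unset Strict Implicit.
Unset Printing Implicit Defensive.

Import Order.TTheory GRing.Theory Num.Theory.
Local Open Scope ring_scope.

(** * Bases indexed by a finite type *)

Section FiniteBasis.
Variables (k : fieldType) (V : lmodType k) (T : finType).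

Lemma dim_card (b : T -> V) :
  (forall c : T -> k, \sum_t c t *: b t = 0 -> forall t, c t = 0) ->
  (forall v, exists c : T -> k, v = \sum_t c t *: b t) ->
  Defs.dim V = (#|T|%:Z)%:E.
Proof.
move=> freeb spanb.
have ev := (onW_bij (fun=> true) (enum_val_bij T)).
apply: (dimE (b := fun i => b (enum_val i))); split=> [c c0 i|v].
  rewrite -[i]enum_valK; apply: (freeb (fun t => c (enum_rank t))).
  rewrite -[RHS]c0 (reindex _ ev) /=.
  by apply: eq_bigr => j _; rewrite enum_valK.
have [c ->] := spanb v; exists (fun i => c (enum_val i)).
by rewrite (reindex _ ev).
Qed.

End FiniteBasis.

(** * Coefficients of the restriction maps *)

Section LaurentCoefficients.
Variable k : fieldType.
Implicit Types (f g : laurent k) (p : {poly k}) (m n e : int).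

Lemma lmonN1X i : lmon k (-1) ^+ i = lmon k (- i%:Z).
Proof.
elim: i => [|i IH]; first by rewrite expr0 lmon0.
by rewrite exprS IH -lmonD; congr lmon; lia.
Qed.

Lemma resBE n p : resB n p = \sum_(i < size p) p`_i *: lmon k (n - i%:Z).
Proof.
rewrite /resB -{1}[p]coefK poly_def raddf_sum mulr_sumr /=.
apply: eq_bigr => i _; rewrite linearZ rmorphXn /= horner_algX lmonN1X.
by rewrite mulr_algl -scalerAr -lmonD.
Qed.

(** No exponent above [n] occurs in the image of [resB n]; this is the source of the bounds by [d.1]
    and [d.2]. *)
Lemma mcoeff_resB n p m :
  (resB n p)@_m = if m <= n then p`_(absz (n - m)) else 0.
Proof.
rewrite resBE raddf_sum /=; under eq_bigr do rewrite mcoeffZ mcoeffU.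
case: ifP => [le_mn|/negP lt_nm]; last first.
  rewrite big1 // => i _; case: eqP => [/= E|_]; last by rewrite mulr0.
  by case: lt_nm; rewrite -E; lia.
have [lt|ge] := ltnP (absz (n - m)) (size p); last first.
  rewrite nth_default // big1 // => i _; case: eqP => [/= E|_]; rewrite ?mulr0 //.
  by move: ge; rewrite -E subKr leqNgt ltn_ord.
rewrite (bigD1 (Ordinal lt)) //= big1 ?addr0 => [|i].
  by rewrite (_ : _ == _) ?mulr1 //; apply/eqP; lia.
rewrite -val_eqE /= => ne; case: eqP => [/= E|_]; last by rewrite mulr0.
by move: ne; rewrite -E subKr eqxx.
Qed.

Lemma mcoeff_resB_sub n p i : (resB n p)@_(n - i%:Z) = p`_i.
Proof.
have le : n - i%:Z <= n by rewrite lerBlDr lerDl.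
by rewrite mcoeff_resB le subKr.
Qed.

Lemma resB_inj n : injective (resB n : {poly k} -> laurent k).
Proof.
move=> p q pq; apply/polyP => i.
by rewrite -(mcoeff_resB_sub n) pq mcoeff_resB_sub.
Qed.

Lemma resBXn n i : resB n ('X^i : {poly k}) = lmon k (n - i%:Z).
Proof. by rewrite /resB rmorphXn /= horner_algX lmonN1X -lmonD. Qed.

Lemma mcoeff_lmon_lsubst m e f n : e != 0 ->
  (lmon k m * lsubst e f)@_(m + e * n) = f@_n.
Proof.
move=> e0; elim/laurent_ind: f => [|f g IHf IHg|c i].
- by rewrite linear0 mulr0 !mcoeff0.
- by rewrite (raddfD (lsubst e)) mulrDr !mcoeffD; congr (_ + _).
rewrite lsubstU [X in X@_ _]lmulUU mul1r !mcoeffU.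
by rewrite (inj_eq (addrI m)) (inj_eq (mulfI e0)).
Qed.

Lemma mcoeff_lmon_lsubst_eq0 m m' e f n :
  (forall i, m' + e * n != m + e * i) ->
  (lmon k m * lsubst e f)@_(m' + e * n) = 0.
Proof.
move=> ne; elim/laurent_ind: f => [|f g IHf IHg|c i].
- by rewrite linear0 mulr0 !mcoeff0.
- by rewrite (raddfD (lsubst e)) mulrDr mcoeffD (f_equal2 +%R IHf IHg) addr0.
by rewrite lsubstU [X in X@_ _]lmulUU mul1r !mcoeffU eq_sym (negbTE (ne i)).
Qed.

(** The other slots contribute nothing, since two indices below [r] that are congruent modulo [r]
    are equal. The hypothesis on [absz e] covers both restrictions from [B3]. *)
Lemma mcoeff_resB3 r e (q : {ffun 'I_r -> laurent k}) (j : 'I_r) n :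
  absz e = r -> (resB3 e q)@_(j%:Z + e * n) = (q j)@_n.
Proof.
move=> er; have lj := ltn_ord j; have e0 : e != 0 by lia.
rewrite /resB3 raddf_sum /= (bigD1 j) //= big1 ?addr0 => [|i].
  exact: mcoeff_lmon_lsubst.
rewrite -val_eqE /= => ij; apply: mcoeff_lmon_lsubst_eq0 => l; apply/eqP => E.
have li := ltn_ord i; move/eqP: ij; case.
have : absz (j%:Z - i%:Z) = (absz e * absz (l - n))%N.
  by rewrite -abszM; congr absz; lia.
by rewrite er; case: (absz (l - n)) => [|h]; nia.
Qed.

End LaurentCoefficients.

(** * The monomial basis of the global sections *)

Section Sections.
Variables (k : fieldType) (r : nat) (d : int * int).
Hypothesis hr : (1 <= r)%N.
Implicit Types (f g : sections (sheafM k r d)) (j : 'I_r) (n : int).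

Definition coefB3 j n f : k := ((f B3 : {ffun 'I_r -> laurent k}) j)@_n.

Lemma coefB3_is_linear j n : linear_for *%R (coefB3 j n).
Proof. by move=> c f g; rewrite /coefB3 /= !ffunE mcoeffD mcoeffZ. Qed.

HB.instance Definition _ j n :=
  GRing.isLinear.Build k (sections (sheafM k r d)) k *%R (coefB3 j n)
    (coefB3_is_linear j n).

Definition admissible j n :=
  (j%:Z + r%:Z * n <= d.1) && (j%:Z + (- r%:Z) * n <= d.2).

(** If the i-th bound fails, the coefficient reappears at [Ai] at an exponent above d_i, where
    nothing restricted from [Bi] has a term. *)
Lemma coefB3_eq0 j n f : ~~ admissible j n -> coefB3 j n f = 0.
Proof.
rewrite negb_and => /orP[] /negbTE gt.
  rewrite /coefB3 -(mcoeff_resB3 (e := r%:Z)) //.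
  have := sfamP f A1B3; rewrite /= => ->; have := sfamP f A1B1; rewrite /= => <-.
  by rewrite mcoeff_resB gt.
rewrite /coefB3 -(mcoeff_resB3 (e := - r%:Z)) ?abszN //.
have := sfamP f A2B3; rewrite /= => ->; have := sfamP f A2B2; rewrite /= => <-.
by rewrite mcoeff_resB gt.
Qed.

(** The value at [B3] fixes those at [A1] and [A2], which fix those at [B1] and [B2] because [resB]
    is injective. *)
Lemma section_ext f g : (forall j n, coefB3 j n f = coefB3 j n g) -> f = g.
Proof.
move=> fg; have fgB3 : f B3 = g B3.
  by apply/ffunP => j; apply/malgP => n; apply: fg.
have fgA1 : f A1 = g A1 by rewrite -(sfamP f A1B3) fgB3 (sfamP g A1B3).
have fgA2 : f A2 = g A2 by rewrite -(sfamP f A2B3) fgB3 (sfamP g A2B3).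
apply: sections_eq => -[] //.
  apply: (@resB_inj k d.1).
  by have /= -> := sfamP f A1B1; have /= -> := sfamP g A1B1.
apply: (@resB_inj k d.2).
by have /= -> := sfamP f A2B2; have /= -> := sfamP g A2B2.
Qed.

Definition monoB3 j n : {ffun 'I_r -> laurent k} :=
  [ffun i => if i == j then lmon k n else 0].

Lemma resB3_mono e j n : resB3 e (monoB3 j n) = lmon k (j%:Z + e * n).
Proof.
rewrite /resB3 (bigD1 j) //= ffunE eqxx lsubst_lmon -lmonD.
by rewrite big1 ?addr0 // => i /negbTE ne; rewrite ffunE ne linear0 mulr0.
Qed.

(** The powers at [B1] and [B2] are forced by [resB]; for admissible [j], [n] the arguments of
    [absz] are nonnegative. *)
Definition mono_fam j n (P : obj) : Mval k r P :=
  match P return Mval k r P with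
  | A1 => lmon k (j%:Z + r%:Z * n)
  | A2 => lmon k (j%:Z + (- r%:Z) * n)
  | B1 => 'X^(absz (d.1 - (j%:Z + r%:Z * n))%R)
  | B2 => 'X^(absz (d.2 - (j%:Z + (- r%:Z) * n))%R)
  | B3 => monoB3 j n
  end.

Lemma resBXn_le m n : m <= n ->
  resB n ('X^(absz (n - m)) : {poly k}) = lmon k m.
Proof. by move=> le; rewrite resBXn gez0_abs ?subr_ge0 // subKr. Qed.

Fact mono_famP j n (adm : admissible j n) P Q (a : arrow P Q) :
  shres (sheafM k r d) a (mono_fam j n Q) = mono_fam j n P.
Proof.
have [le1 le2] := andP adm.
by case: a => /=; rewrite ?resBXn_le ?resB3_mono.
Qed.

Definition mono_section j n adm : sections (sheafM k r d) :=
  @Sections k (sheafM k r d) (mono_fam j n) (mono_famP adm).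

Lemma coefB3_mono i m j n adm :
  coefB3 i m (@mono_section j n adm) = ((i, m) == (j, n))%:R.
Proof.
rewrite /coefB3 /= ffunE xpair_eqE; case: (i == j); rewrite ?mcoeff0 //.
by rewrite mcoeffU eq_sym.
Qed.

(* The number of integers from [- ((d.2 - j) %/ r)] to [(d.1 - j) %/ r]. *)
Definition nadm j : nat :=
  absz (Num.max 0 (((d.1 - j%:Z) %/ r)%Z + ((d.2 - j%:Z) %/ r)%Z + 1)).

Definition expn_of (t : {j : 'I_r & 'I_(nadm j)}) : int :=
  (tagged t)%:Z - ((d.2 - (tag t)%:Z) %/ r)%Z.

Lemma admissibleE j n : admissible j n =
  (- ((d.2 - j%:Z) %/ r)%Z <= n <= ((d.1 - j%:Z) %/ r)%Z).
Proof.
have r0 : 0 < r%:Z by lia.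
rewrite /admissible andbC lez_divRL // lerNl lez_divRL //.
by rewrite !lerBrDl mulNr (mulrC n) (mulrC (- n)) mulrN.
Qed.

Lemma expn_of_admissible t : admissible (tag t) (expn_of t).
Proof.
rewrite admissibleE /expn_of; case: t => j i /=; have := ltn_ord i.
rewrite {2}/nadm; move: (divz _ _) (divz _ _) => a b; lia.
Qed.

Lemma admissible_expn_of j n : admissible j n ->
  exists t, tag t = j /\ expn_of t = n.
Proof.
rewrite admissibleE => adm.
have lt : (absz (n + ((d.2 - j%:Z) %/ r)%Z)%R < nadm j)%N.
  rewrite /nadm; move: adm; move: (divz _ _) (divz _ _) => a b; lia.
exists (existT _ j (Ordinal lt)); split=> //; rewrite /expn_of /=.
by move: adm; move: (divz _ _) (divz _ _) => a b; lia.
Qed.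

Lemma expn_of_inj t u :
  ((tag t, expn_of t) == (tag u, expn_of u)) = (t == u).
Proof.
apply/eqP/eqP => [|-> //]; case: t u => [j a] [j' b] [/= jj']; subst j'.
rewrite /expn_of /= => /addIr [] /val_inj -> //.
Qed.

Lemma b0_sum : b0 (sheafM k r d) = ((\sum_(j < r) nadm j)%N%:Z)%:E.
Proof.
pose b t := mono_section (expn_of_admissible t).
(* The coefficient functionals are dual to the family [b], which gives both its independence and the
   coordinates of a section. *)
have coefb (c : _ -> k) t :
    coefB3 (tag t) (expn_of t) (\sum_u c u *: b u) = c t.
  rewrite linear_sum (bigD1 t) //= linearZ /= coefB3_mono eqxx mulr1.
  rewrite big1 ?addr0 // => u ne; rewrite linearZ /= coefB3_mono.
  by rewrite expn_of_inj eq_sym (negbTE ne) mulr0.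
rewrite /b0 (dim_card (b := b)).
- rewrite card_tagged sumnE big_map big_enum /=.
  by under eq_bigr do rewrite card_ord.
- by move=> c c0 t; rewrite -[LHS](coefb c t) c0 linear0.
move=> f; exists (fun t => coefB3 (tag t) (expn_of t) f).
apply: section_ext => j n; have [adm|not_adm] := boolP (admissible j n).
  by have [t [<- <-]] := admissible_expn_of adm; rewrite coefb.
by rewrite !coefB3_eq0.
Qed.

End Sections.

(** * The graph rank through floor quotients *)

Section Rank.
Variables (r : nat) (d : int * int).
Hypothesis hr : (1 <= r)%N.

(** Subtracting z (r, -r) leaves an effective divisor exactly when z is at most the first quotient
    and -z at most the second. *)
Lemma equiv_effectiveP (e : int * int) :
  equiv_effective r e <-> 0 <= (e.1 %/ r)%Z + (e.2 %/ r)%Z.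
Proof.
have r0 : 0 < r%:Z by lia.
split=> [[f [[z efz] [f1 f2]]]|e0].
  have /(congr1 fst) := efz; have /(congr1 snd) := efz.
  rewrite !raddfMz /= !mulrzz => E2 E1.
  have le1 : z <= (e.1 %/ r)%Z by rewrite lez_divRL //; lia.
  have le2 : - z <= (e.2 %/ r)%Z by rewrite lez_divRL //; lia.
  by lia.
set z := (e.1 %/ r)%Z in e0.
have le1 : z * r%:Z <= e.1 by rewrite -lez_divRL.
have le2 : - z * r%:Z <= e.2 by rewrite -lez_divRL //; lia.
exists (e.1 - r%:Z * z, e.2 + r%:Z * z); split; last by split=> /=; lia.
exists z; case: e {e0 le1 le2} @z => e1 e2 /=.
set z := (_ %/ _)%Z; apply/eqP; rewrite eqE /= !raddfMz /= !mulrzz; lia.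
Qed.

(** The quotients are at most q - 1 and -q. This certifies the divisors that bound the rank from
    above. *)
Lemma divz_sum_lt0 (q x y : int) :
  x < q * r%:Z -> y < (1 - q) * r%:Z -> (x %/ r)%Z + (y %/ r)%Z < 0.
Proof.
have r0 : 0 < r%:Z by lia.
rewrite !ltNge -!lez_divRL //; lia.
Qed.

(** Since [j < r], the subtraction borrows at most once, namely when [j] exceeds the remainder. *)
Lemma divz_sub_small (x : int) (j : nat) : (j < r)%N ->
  ((x - j%:Z) %/ r)%Z = (x %/ r)%Z - (~~ (j%:Z <= (x %% r)%Z))%:Z.
Proof.
move=> ltjr; have r0 : 0 < r%:Z by lia.
have rn0 : r%:Z != 0 by lia.
have s0 := modz_ge0 x rn0; have sr := ltz_pmod x r0.
rewrite {1}(divz_eq x r) -addrA divzMDl //; congr (_ + _).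
case: (lerP j%:Z (x %% r)%Z) => le /=.
  by rewrite divz_small //; lia.
rewrite (_ : _ - _ = (-1) * r%:Z + ((x %% r)%Z - j%:Z + r%:Z)); last by lia.
by rewrite divzMDl // divz_small ?addr0 //; lia.
Qed.

Lemma sum_leq (n s : nat) : (\sum_(j < n) (j <= s) = minn n s.+1)%N.
Proof.
elim: n => [|n IH]; first by rewrite big_ord0 min0n.
by rewrite big_ord_recr /= IH; lia.
Qed.

Lemma GRRR_eq m : equiv_effective r d -> is_max_rank r d m -> GRRR r d = m%:Z.
Proof.
move=> dE [mP mM]; have [n [[nP nM] ->]] := GRRR_max dE.
by congr Posz; apply/eqP; rewrite eqn_leq mM // nM.
Qed.

Lemma GRRR_nadm : GRRR r d + 1 = (\sum_(j < r) nadm d j)%N%:Z.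
Proof.
have r0 : 0 < r%:Z by lia.
have rn0 : r%:Z != 0 by lia.
have nadmE (j : 'I_r) : nadm d j = absz (Num.max 0
    ((d.1 %/ r)%Z + (d.2 %/ r)%Z + 1
     - (~~ (j%:Z <= (d.1 %% r)%Z))%:Z - (~~ (j%:Z <= (d.2 %% r)%Z))%:Z)).
  by rewrite /nadm !divz_sub_small //; congr absz; congr Num.max; lia.
under eq_bigr do rewrite nadmE; move: {nadmE} (equiv_effectiveP d).
have := divz_eq d.1 r; have := divz_eq d.2 r.
have := modz_ge0 d.1 rn0; have := modz_ge0 d.2 rn0.
have := ltz_pmod d.1 r0; have := ltz_pmod d.2 r0.
case: (d.1 %% r)%Z => // s1; case: (d.2 %% r)%Z => // s2.
move: (d.1 %/ r)%Z (d.2 %/ r)%Z => q1 q2 lt2 lt1 _ _ d2E d1E dP.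
(* A counterexample is asked for in every degree above [m], so no monotonicity of [rank_ge] has to
   be proved. *)
have maxP m : (forall a b : int, 0 <= a -> 0 <= b -> a + b = m%:Z ->
    0 <= ((d.1 - a) %/ r)%Z + ((d.2 - b) %/ r)%Z) ->
  (forall n : nat, (m < n)%N -> exists a b : int,
    [/\ 0 <= a, 0 <= b, a + b = n%:Z
      & ((d.1 - a) %/ r)%Z + ((d.2 - b) %/ r)%Z < 0]) ->
  is_max_rank r d m.
  move=> ge lt; split=> [e [e1 e2] em|n nP]; first exact/equiv_effectiveP/ge.
  rewrite leqNgt; apply/negP => /lt[a [b [a0 b0 ab]]]; apply/negP.
  rewrite -leNgt; exact/(equiv_effectiveP (d - (a, b)))/nP.
have [D0|D0] := ltP (q1 + q2) 0.
  rewrite /GRRR asboolF; last by move/dP; lia.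
  by rewrite big1 // => j _; lia.
have [Dpos|Dle0] := ltP 0 (q1 + q2); last first.
  have q2E : q2 = - q1 by lia.
  (* When the quotients sum to 0, a slot counts once if neither subtraction borrows, and not at all
     otherwise. *)
  rewrite (eq_bigr (fun j : 'I_r => (j <= minn s1 s2) : nat)) => [|j _]; last first.
    by lia.
  rewrite sum_leq (@GRRR_eq (minn s1 s2)); first by lia.
    by apply/dP.
  apply: maxP => [a b a0 b0 ab|n ltn].
    (* Both a and b are at most min (s1, s2), so neither quotient drops. *)
    have : q1 <= ((d.1 - a) %/ r)%Z by rewrite lez_divRL //; lia.
    have : q2 <= ((d.2 - b) %/ r)%Z by rewrite lez_divRL //; lia.
    lia.
  (* Taking one more than the smaller remainder from its own component lowers that quotient, and the
     other cannot grow. *)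
  have [le|gt] := leqP s1 s2.
    exists s1.+1%:Z, (n%:Z - s1.+1%:Z); split; try lia.
    by apply: (@divz_sum_lt0 q1); lia.
  exists (n%:Z - s2.+1%:Z), s2.+1%:Z; split; try lia.
  by rewrite addrC; apply: (@divz_sum_lt0 q2); lia.
(* This [D] is q1 + q2 - 1, one less than the D of the overview. *)
have [D DE] : exists D : nat, q2 = D%:Z + 1 - q1.
  by exists (absz (q1 + q2 - 1)%R); lia.
rewrite (eq_bigr (fun j : 'I_r => D + (j <= s1) + (j <= s2))%N) => [|j _]; last first.
  by lia.
rewrite !big_split /= !sum_leq sum_nat_const card_ord.
rewrite (@GRRR_eq (r * D + s1 + s2 + 1)%N); first by lia.
  by apply/dP; lia.
apply: maxP => [a b a0 b0 ab|n ltn].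
  (* The two degrees sum to r - 1, so with d.1 - a = z r + x the other one is
     - z r + (r - 1 - x) with r - 1 - x >= 0. *)
  set z := (_ %/ _)%Z; have zE := divz_eq (d.1 - a) r.
  have x0 := modz_ge0 (d.1 - a) rn0; have xr := ltz_pmod (d.1 - a) r0.
  have : - z <= ((d.2 - b) %/ r)%Z by rewrite lez_divRL //; rewrite -/z in zE; lia.
  lia.
(* The first component becomes q1 r - 1; as at most r - 2 remains in total, the second is at most (1
   - q1) r - 1. *)
exists s1.+1%:Z, (n%:Z - s1.+1%:Z); split; try lia.
by apply: (@divz_sum_lt0 q1); lia.
Qed.

End Rank.

Theorem theorem5p5 (k : fieldType) (r : nat) (hr : (1 <= r)%N) (d : int * int) :
  b0 (sheafM k r d) = (GRRR r d + 1)%:E.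
Proof. by rewrite b0_sum // GRRR_nadm. Qed.
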